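(* Let $q$ be a power of a prime number, let $G_q$ be an $\widetilde{A}_2$-group of order $q$, and let $\pi$ be a uniformly bounded representation of $G_q$ on a Hilbert space $H$ satisfying $$\sup_{g\in G_q}\Vert \pi_g\Vert < \sqrt{2\left(1-\dfrac{\sqrt{q}}{q+1}\right)}.$$ Then $H^1(G_q,\pi)=0$.
   Context: $\widetilde{A}_2$-groups. For a group $G$ with a finite symmetric generating set $S=S^{-1}$ not containing the identity, the link graph $\mathcal{L}(S)$ has vertex set $S$, with $s,t\in S$ joined by an edge iff $s^{-1}t\in S$ (equivalently $t^{-1}s\in S$). The $\widetilde{A}_2$-group $G_q$ has a finite symmetric generating set $S$, not containing the identity, whose link graph $\mathcal{L}(S)$ is the incidence graph of the finite projective plane $\mathbf{P}^2(\mathbb{F}_q)$, i.e. the bipartite graph whose vertices are the $q^2+q+1$ points and the $q^2+q+1$ lines of $\mathbf{P}^2(\mathbb{F}_q)$, a point and a line being joined iff they are incident. For the purposes of this statement, ''an $\widetilde{A}_2$-group of order $q$'' means a group admitting such a generating set. A uniformly bounded representation of $G$ on $H$ is a homomorphism $\pi$ from $G$ to the group of bounded invertible linear operators on $H$ with $\sup_{g}\|\pi_g\|<\infty$ (operator norm). A 1-cocycle for $\pi$ is a map $b:G\to H$ with $b_{gh}=\pi_g b_h+b_g$ for all $g,h\in G$; a coboundary is a cocycle of the form $b_g=v-\pi_g v$ for some $v\in H$. $H^1(G,\pi)$ is the quotient of cocycles by coboundaries. *)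

(* Defs.v *)
From HB Require Import structures.
From mathcomp Require Import all_boot all_order all_algebra finmap complex.
From mathcomp Require Import all_classical all_reals ereal normedtype.

Set Implicit Arguments.
Unset Strict Implicit.
Unset Printing Implicit Defensive.

Import Order.TTheory GRing.Theory Num.Theory.
Import numFieldNormedType.Exports.

Local Open Scope ring_scope.

Section ProjectivePlane.
Variable F : finFieldType.

(* The points and lines of P^2(F) are the 1- and 2-dimensional subspaces of
   F^3, and incidence is inclusion. *)
Definition point := {U : {vspace 'rV[F]_3} | \dim U == 1%N}.
Definition line := {U : {vspace 'rV[F]_3} | \dim U == 2%N}.

Definition incident (x : point) (l : line) : bool := (val x <= val l)%VS.

Definition incidence_graph : rel (point + line) := fun u v =>
  match u, v with
  | inl x, inr l => incident x l
  | inr l, inl x => incident x l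
  | _, _ => false
  end.

End ProjectivePlane.

Definition graph_isomorphic (V W : Type) (e : rel V) (e' : rel W) : Prop :=
  exists2 f : V -> W, bijective f & forall x y, e' (f x) (f y) = e x y.

Section A2Groups.
Variable G : groupType.

Definition generates (S : {fset G}) : Prop :=
  forall A : {pred G}, group_closed A -> {subset S <= A} -> A =i predT.

Definition link_graph (S : {fset G}) : rel S :=
  fun s t => ((val s)^-1 * val t)%g \in S.

Definition A2tilde_group (q : nat) : Prop :=
  exists S : {fset G},
    [/\ generates S,
        forall s, s \in S -> (s^-1)%g \in S,
        1%g \notin S &
        exists2 F : finFieldType,
          #|F| = q & graph_isomorphic (link_graph (S := S)) (@incidence_graph F)].

End A2Groups.

(* Hilbert spaces are taken over either the real or the complex numbers. *)
Variant scalars := RealScalars | ComplexScalars.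

Section HilbertSpaces.
Variable R : realType.

Definition scalar_field (k : scalars) : numFieldType :=
  match k with RealScalars => R | ComplexScalars => R[i] end.

Definition scalar_conj (k : scalars) : scalar_field k -> scalar_field k :=
  match k with
  | RealScalars => fun x : R => x
  | ComplexScalars => fun z : R[i] => Num.conj z
  end.

(* Norms of a normedModType over R[i] are (real) elements of R[i]; this brings
   them back to R. *)
Definition scalar_re (k : scalars) : scalar_field k -> R :=
  match k with
  | RealScalars => fun x : R => x
  | ComplexScalars => fun z : R[i] => complex.Re z
  end.

Record hilbertSpace (k : scalars) := HilbertSpace {
  hilbert_sort :> completeNormedModType (scalar_field k);
  hilbert_dot : {dot hilbert_sort for @scalar_conj k};
  hilbert_dotE : forall x : hilbert_sort, hilbert_dot x x = `|x| ^+ 2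
}.
Arguments hilbert_dot {k} h.

Variables (k : scalars) (H : hilbertSpace k).

(* Extended-real valued: T is a bounded operator iff opnorm T < +oo. *)
Definition opnorm (T : H -> H) : \bar R :=
  ereal_sup [set (scalar_re `|T x|)%:E | x in [set x : H | `|x| <= 1]]%classic.

Definition bounded_invertible (T : {linear H -> H}) : Prop :=
  (opnorm T < +oo)%E /\
  exists T' : {linear H -> H},
    [/\ cancel T T', cancel T' T & (opnorm T' < +oo)%E].

Variable G : groupType.

Definition rep_norm (pi : G -> {linear H -> H}) : \bar R :=
  ereal_sup [set opnorm (pi g) | g in [set: G]]%classic.

Definition uniformly_bounded_rep (pi : G -> {linear H -> H}) : Prop :=
  [/\ forall g, bounded_invertible (pi g),
      forall g h x, pi (g * h)%g x = pi g (pi h x) &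
      (rep_norm pi < +oo)%E].

Definition cocycle (pi : G -> {linear H -> H}) (b : G -> H) : Prop :=
  forall g h, b (g * h)%g = pi g (b h) + b g.

Definition coboundary (pi : G -> {linear H -> H}) (b : G -> H) : Prop :=
  exists v : H, forall g, b g = v - pi g v.

(* H^1(G, pi) = 0: the quotient of cocycles by coboundaries is trivial. *)
Definition H1_vanishes (pi : G -> {linear H -> H}) : Prop :=
  forall b : G -> H, cocycle pi b -> coboundary pi b.

End HilbertSpaces.

(* Main.v *)
(* View H as a real Hilbert space. For a cocycle b on S, b_t - b_s =
   pi_s b_{s^-1 t} along the edges of the link graph, so the energy of b on the
   link is at most K (q+1) sum_s |b_s|^2 with K = sup |pi_g|^2. The spectral gap
   q + 1 - sqrt q of the incidence graph bounds this energy from below, and as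
   K < 2 (1 - sqrt q / (q+1)) this gives |sum_s b_s|^2 >= kappa sum_s |b_s|^2
   with kappa > 0. The same holds for the contragredient representation sigma.
   The map v |-> (v - pi_s v)_s and twice the sum over S on the cocycles of
   sigma are adjoint, so by Riesz (for the form given by the sum over S on the
   cocycles of sigma) a coboundary can be subtracted from b to make it
   orthogonal to the cocycles of sigma. Testing against the coboundaries of
   sigma, what remains has zero sum over S, hence vanishes. *)
Require Import Defs.
From HB Require Import structures.
From mathcomp Require Import all_boot all_order all_algebra finmap complex.
From mathcomp Require Import all_classical all_reals ereal normedtype.
From mathcomp Require Import all_field ring lra zify.

Set Implicit Arguments.
Unset Strict Implicit.
Unset Printing Implicit Defensive.

Import Order.TTheory GRing.Theory Num.Theory.
Import numFieldNormedType.Exports.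

Local Open Scope ring_scope.

(** * Elementary inequalities over ordered fields, and a null sequence *)

Lemma discriminant_le0 (R : realFieldType) (a b c : R) :
  0 <= a -> (forall t, 0 <= a * t ^+ 2 + 2 * b * t + c) -> b ^+ 2 <= a * c.
Proof.
rewrite le_eqVlt => /predU1P[<- h|a_gt0 h].
  have [->|b0] := eqVneq b 0; first by rewrite expr0n mul0r.
  (* With [a = 0] the polynomial is affine, and this [t] is where it equals [-1]. *)
  have := h (- (c + 1) / (2 * b)).
  have -> : 0 * (- (c + 1) / (2 * b)) ^+ 2 + 2 * b * (- (c + 1) / (2 * b)) + c
    = - 1 by field.
  lra.
have := h (- b / a).
have -> : a * (- b / a) ^+ 2 + 2 * b * (- b / a) + c = (a * c - b ^+ 2) / a.
  by field; rewrite gt_eqF.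
by rewrite pmulr_lge0 ?invr_gt0// subr_ge0.
Qed.

Lemma AMGM_sqr (R : realFieldType) (x y z : R) :
  0 <= y -> 0 <= z -> x ^+ 2 <= y * z -> 2 * x <= y + z.
Proof.
move=> y0 z0 h; apply: le_trans (ler_norm _) _.
rewrite -(ler_pXn2r (n := 2)) ?nnegrE ?normr_ge0 ?addr_ge0//.
rewrite real_normK ?num_real//; have := sqr_ge0 (y - z) => *; nra.
Qed.

Lemma vanishing_sequence (R : archiRealFieldType) :
  exists2 eps : nat -> R, forall n, 0 < eps n &
    forall e, 0 < e -> exists N, forall n, (N <= n)%N -> eps n < e.
Proof.
exists (fun n => n.+1%:R^-1) => [n|e e0]; first by rewrite invr_gt0 ltr0n.
exists (Num.truncn e^-1) => n hn; rewrite invf_plt ?posrE ?ltr0n//.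
by apply: lt_le_trans (truncnS_gt _) _; rewrite ler_nat ltnS.
Qed.

(** * Positive semidefinite forms and Riesz representation *)

Section PositiveForms.
Variables (R : realType) (V : lmodType R).
Implicit Types (B : V -> V -> R) (P : V -> Prop).

(** Semidefinite on purpose: Riesz is applied later to the form of [psd_form_of_sum], which vanishes
    on every family with zero sum. *)
Record psd_form B : Prop := PsdForm {
  ipC : forall x y, B x y = B y x;
  ipPl : forall a x y z, B (a *: x + y) z = a * B x z + B y z;
  ip_ge0 : forall x, 0 <= B x x
}.

Definition subspace P :=
  P 0 /\ forall a x y, P x -> P y -> P (a *: x + y).

(** Here and in [form_cvg], [e] bounds the squared seminorm, which avoids square roots. *)
Definition form_cauchy B (u : nat -> V) := forall e : R, 0 < e ->
  exists N, forall m n, (N <= m)%N -> (N <= n)%N -> B (u m - u n) (u m - u n) < e.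

Definition form_cvg B (u : nat -> V) l := forall e : R, 0 < e ->
  exists N, forall n, (N <= n)%N -> B (u n - l) (u n - l) < e.

Definition form_complete B P := forall u, (forall n, P (u n)) ->
  form_cauchy B u -> exists2 l, P l & form_cvg B u l.

Section FormTheory.
Variable B : V -> V -> R.
Hypothesis psdB : psd_form B.

Lemma ip0l z : B 0 z = 0.
Proof.
have := ipPl psdB 1 0 0 z; rewrite scaler0 addr0 mul1r => h.
by apply: (addrI (B 0 z)); rewrite addr0 -h.
Qed.

Lemma ipDl x y z : B (x + y) z = B x z + B y z.
Proof. by rewrite -[x in LHS]scale1r (ipPl psdB) mul1r. Qed.

Lemma ipZl a x z : B (a *: x) z = a * B x z.
Proof. by rewrite -[_ *: x]addr0 (ipPl psdB) ip0l addr0. Qed.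

Lemma ipNl x z : B (- x) z = - B x z.
Proof. by rewrite -scaleN1r ipZl mulN1r. Qed.

Lemma ipBl x y z : B (x - y) z = B x z - B y z.
Proof. by rewrite ipDl ipNl. Qed.

Lemma ip_suml I r (Q : pred I) (f : I -> V) z :
  B (\sum_(i <- r | Q i) f i) z = \sum_(i <- r | Q i) B (f i) z.
Proof.
apply: (big_morph (B^~ z)) => [x y|]; [exact: ipDl | exact: ip0l].
Qed.

Lemma ip0r z : B z 0 = 0.
Proof. by rewrite (ipC psdB) ip0l. Qed.

Lemma ipDr z x y : B z (x + y) = B z x + B z y.
Proof. by rewrite !(ipC psdB z) ipDl. Qed.

Lemma ipZr z a x : B z (a *: x) = a * B z x.
Proof. by rewrite !(ipC psdB z) ipZl. Qed.

Lemma ipNr z x : B z (- x) = - B z x.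
Proof. by rewrite !(ipC psdB z) ipNl. Qed.

Lemma ipBr z x y : B z (x - y) = B z x - B z y.
Proof. by rewrite !(ipC psdB z) ipBl. Qed.

Lemma ip_sumr I r (Q : pred I) (f : I -> V) z :
  B z (\sum_(i <- r | Q i) f i) = \sum_(i <- r | Q i) B z (f i).
Proof. by rewrite (ipC psdB) ip_suml; apply: eq_bigr => i _; rewrite (ipC psdB). Qed.

Lemma ip_sqrD x y : B (x + y) (x + y) = B x x + 2 * B x y + B y y.
Proof. by rewrite !ipDl !ipDr (ipC psdB y x); ring. Qed.

Lemma ip_sqrB x y : B (x - y) (x - y) = B x x - 2 * B x y + B y y.
Proof. by rewrite !ipBl !ipBr (ipC psdB y x); ring. Qed.

Lemma ip_CauchySchwarz x y : B x y ^+ 2 <= B x x * B y y.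
Proof.
rewrite mulrC; apply: discriminant_le0 => [|t]; first exact: ip_ge0.
have := ip_ge0 psdB (x + t *: y).
suff -> : B (x + t *: y) (x + t *: y) = B y y * t ^+ 2 + 2 * B x y * t + B x x by [].
by rewrite ip_sqrD !ipZr !ipZl; ring.
Qed.

Lemma ip_AMGM x y r : 0 < r -> 2 * B x y <= r * B x x + B y y / r.
Proof.
move=> r0; have r0' := ltW r0.
apply: AMGM_sqr; [exact: mulr_ge0 (ip_ge0 psdB x)|exact: divr_ge0 (ip_ge0 psdB y) _|].
have -> : r * B x x * (B y y / r) = B x x * B y y by field; rewrite gt_eqF.
exact: ip_CauchySchwarz.
Qed.

Section Riesz.
Variables (P : V -> Prop) (phi : V -> R) (K : R).
Hypotheses (subP : subspace P) (complP : form_complete B P).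
Hypothesis phiP : forall a x y, phi (a *: x + y) = a * phi x + phi y.
Hypothesis phi_bnd : forall x, P x -> phi x ^+ 2 <= K * B x x.

(** If [c] represents [phi], this is [B (x - c) (x - c) - B c c], which is smallest at [c]. *)
Let J x := B x x - 2 * phi x.

Let phi0 : phi 0 = 0.
Proof. by have := phiP (-1) 0 0; rewrite scaleN1r oppr0 addr0 mulN1r addNr. Qed.

Let phiZ a x : phi (a *: x) = a * phi x.
Proof. by rewrite -[a *: x]addr0 phiP phi0 addr0. Qed.

Let phiD x y : phi (x + y) = phi x + phi y.
Proof. by rewrite -[x in LHS]scale1r phiP mul1r. Qed.

Let J_ge x : P x -> - `|K| <= J x.
Proof.
move=> Px; rewrite /J lerBrDr addrC lerBlDr.
apply: AMGM_sqr; [exact: ip_ge0 psdB x | exact: normr_ge0 | rewrite mulrC].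
by apply: le_trans (phi_bnd Px) _; rewrite ler_wpM2r ?ler_norm//; exact: ip_ge0.
Qed.

Let parallelogram x y :
  B (x - y) (x - y) = 2 * J x + 2 * J y - 4 * J (2^-1 *: (x + y)).
Proof.
by rewrite /J ip_sqrB phiZ phiD !(ipZl, ipZr) ip_sqrD; field.
Qed.

Let PZD a x y : P x -> P y -> P (a *: (x + y)).
Proof.
have [P0 PP] := subP => Px Py; rewrite -[_ *: _]addr0; apply: (PP) => //.
by rewrite -[x]scale1r; apply: (PP).
Qed.

(* The representing vector minimizes [J] on [P]; a minimizing sequence is
   Cauchy by the parallelogram law. *)
Lemma riesz_representation : exists2 c, P c & forall x, P x -> phi x = B c x.
Proof.
pose E : set R := [set J x | x in [set x | P x]]%classic.
have [P0 PP] := subP.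
have infE : has_inf E.
  split; first by exists (J 0); exists 0.
  by exists (- `|K|) => _ [x Px <-]; exact: J_ge.
have leJ x : P x -> inf E <= J x.
  by move=> Px; apply: (ge_inf infE.2); exists x.
have [eps eps_gt0 small] := vanishing_sequence R.
have /choice[u uP] (n : nat) : exists x, P x /\ J x < inf E + eps n.
  by have [_ [x Px <-] ?] := inf_adherent (eps_gt0 n) infE; exists x.
have uP1 n := (uP n).1; have uP2 n := (uP n).2.
have [|l Pl ul] := complP uP1.
  (* Two values of [J] within [e / 4] of the infimum and a midpoint value at least the infimum make
     the right side of [parallelogram] less than [e]. *)
  move=> e e0; have [|N hN] := small (e / 4); first lra.
  exists N => m n /hN hm /hN hn; rewrite parallelogram.
  have := leJ _ (PZD 2^-1 (uP1 m) (uP1 n)).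
  have := uP2 m; have := uP2 n => *; lra.
exists l => // z Pz; apply/eqP; rewrite eq_sym -subr_eq0 -sqrf_eq0.
rewrite eq_le sqr_ge0 andbT; apply/ler_addgt0Pr => e e0; rewrite add0r.
(* The factor [4] pays for [(x - y)^2 <= 2 x^2 + 2 y^2] with both squares at most [e1 * B z z]; the
   [+ 1] is there because [B z z] may vanish. *)
pose e1 := e / (4 * (B z z + 1)).
have Bz0 := ip_ge0 psdB z.
have e10 : 0 < e1 by rewrite divr_gt0//; lra.
have [N1 h1] := small e1 e10; have [N2 h2] := ul e1 e10.
have {h1} := h1 _ (leq_maxl N1 N2); have {h2} := h2 _ (leq_maxr N1 N2).
move: (maxn N1 N2) => n h2 h1.
(* Moving from [u n] along [z] lowers [J] by at most [eps n]; this is a quadratic inequality in [t],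
   and [d1] is its discriminant condition. *)
have d1 : (B (u n) z - phi z) ^+ 2 <= B z z * eps n.
  apply: discriminant_le0 => // t.
  have Pt : P (t *: z + u n) by exact: (PP).
  have := leJ _ Pt; have := uP2 n.
  rewrite /J phiP ip_sqrD !ipZl !ipZr (ipC psdB z (u n)) => *; nra.
have d2 := ip_CauchySchwarz (u n - l) z; rewrite ipBl in d2.
have e1E : e = 4 * (e1 * B z z + e1) by rewrite /e1; field; lra.
have d3 : B (u n - l) (u n - l) * B z z <= e1 * B z z by rewrite ler_wpM2r// ltW.
have d4 : B z z * eps n <= e1 * B z z by rewrite mulrC ler_wpM2r// ltW.
move: d1 d2 d3 d4; set X := B (u n) z; set Y := B l z; set Z := phi z.
move=> d1 d2 d3 d4; have := sqr_ge0 (X - Z + (X - Y)) => *; nra.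
Qed.

End Riesz.
End FormTheory.
End PositiveForms.

(** * Spectral gap of the incidence graph of a projective plane *)

(** The vertices in [side] are the points. Regularity and [pg_join] determine the square of the
    adjacency matrix on the points, from which the gap is derived. *)
Record plane_graph (T : finType) (e : rel T) (side : pred T) (q : nat) : Prop :=
  PlaneGraph {
  pg_sym : symmetric e;
  pg_bip : forall s t, e s t -> side s = ~~ side t;
  pg_deg : forall s, (\sum_t e s t)%N = q.+1;
  pg_join : forall s s', side s -> side s' -> s != s' ->
    (\sum_t e s t * e s' t)%N = 1%N
}.

Section SpectralGap.
Variables (R : realType) (V : lmodType R) (B : V -> V -> R).
Hypothesis psdB : psd_form B.
Variables (T : finType) (e : rel T) (side : pred T) (q : nat).
Hypotheses (pgT : plane_graph e side q) (q_gt0 : (0 < q)%N).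

Let d : R := q%:R + 1.
Let r : R := Num.sqrt q%:R.
Let E s t : R := (e s t)%:R.

Let ER s : \sum_t E s t = d.
Proof. by rewrite -natr_sum (pg_deg pgT) mulrSr. Qed.

Let EC s t : E s t = E t s.
Proof. by rewrite /E (pg_sym pgT). Qed.

Let E0 s t : side s = side t -> E s t = 0.
Proof.
rewrite /E => st; case est: (e s t) => //; move: (pg_bip pgT est).
by rewrite st; case: (side t).
Qed.

(** For the point-line incidence matrix [N], this says that [N N^T] is the all-ones matrix plus [q]
    times the identity: the source of the eigenvalue [sqrt q]. *)
Let EE s s' : side s -> side s' ->
  \sum_(t | ~~ side t) E s t * E s' t = 1 + (if s == s' then q%:R else 0).
Proof.
move=> Ps Ps'; rewrite big_mkcond/=.
rewrite (eq_bigr (fun t => (e s t * e s' t)%N%:R)) => [|t _]; last first.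
  by case: ifPn => [_|/negPn t1]; rewrite natrM// -/(E s t) E0 ?mul0r// Ps.
rewrite -natr_sum; have [<-|ss'] := eqVneq s s'.
  rewrite (eq_bigr (fun t => nat_of_bool (e s t))) => [|t _]; last by case: (e s t).
  by rewrite (pg_deg pgT) mulrS.
by rewrite (pg_join pgT) ?addr0.
Qed.

(** Counting edges from both sides gives as many lines as points ([lP]); counting paths of length
    two from a point [s0] to the points gives [d ^+ 2] as the number of points plus [q] ([d2]). *)
Let card_lines : \sum_(t | ~~ side t) 1 <= d ^+ 2.
Proof.
have d0 : 0 < d by rewrite /d ltr_wpDl.
have lP : \sum_(t | ~~ side t) 1 * d = \sum_(s | side s) d.
  under eq_bigr => t _ do rewrite mul1r -(ER t).
  rewrite exchange_big/= [RHS]big_mkcond/=; apply: eq_bigr => s _.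
  rewrite -(ER s) big_mkcond/=; case: ifPn => [Ps|nPs]; last first.
    rewrite big1// => t _; case: ifPn => // nPt; rewrite E0//.
    by rewrite (negPf nPt) (negPf nPs).
  apply: eq_bigr => t _; rewrite EC; case: ifPn => // /negPn Pt.
  by rewrite E0// Ps Pt.
rewrite -(ler_pM2r d0) mulr_suml lP.
have [s0 Ps0|no] := pickP side; last by rewrite big_pred0 ?mulr_ge0 ?sqr_ge0 ?ltW.
have d2 : \sum_(s | side s) (1 + (if s0 == s then q%:R else 0)) = d * d.
  under eq_bigr => s Ps do rewrite -(EE Ps0 Ps).
  rewrite exchange_big/= -{1}(ER s0) mulr_suml [LHS]big_mkcond/=.
  apply: eq_bigr => t _; case: ifPn => [nPt|/negPn Pt]; last first.
    by rewrite E0 ?mul0r// Ps0 Pt.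
  rewrite -mulr_sumr -(ER t); congr (_ * _); rewrite big_mkcond/=.
  apply: eq_bigr => s _; rewrite EC; case: ifPn => // nPs.
  by rewrite E0// (negPf nPs) (negPf nPt).
rewrite expr2 -[X in X <= _]mul1r mulr_sumr.
under eq_bigr do rewrite mul1r -[d]mul1r.
rewrite -mulr_suml ler_pM2r// -d2 ler_sum// => s _.
by rewrite lerDl; case: ifP.
Qed.

(* AM-GM applied on each line [t] to [2 <f t, u t - a>], where [u t] is the sum
   of [f] over the points of [t]. The shift [a], the sum of [f] over all points
   divided by [q + 1], absorbs the eigenvalue [q + 1] of the constant functions. *)
Lemma plane_graph_form_le (f : T -> V) : \sum_s f s = 0 ->
  \sum_s \sum_t E s t * B (f s) (f t) <= r * \sum_s B (f s) (f s).
Proof.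
move=> f0; have r0 : 0 < r by rewrite sqrtr_gt0 ltr0n.
have r2 : r ^+ 2 = q%:R by rewrite sqr_sqrtr.
have d0 : 0 < d by rewrite /d ltr_wpDl.
pose TP := \sum_(s | side s) f s; pose TL := \sum_(t | ~~ side t) f t.
have TLE : TL = - TP.
  by apply/eqP; rewrite -addr_eq0 addrC -f0 [X in _ == X](bigID side).
pose u t := \sum_(s | side s) E s t *: f s.
pose a := d^-1 *: TP.
have lhs : \sum_s \sum_t E s t * B (f s) (f t) =
    2 * \sum_(t | ~~ side t) B (f t) (u t).
  have half : \sum_(t | ~~ side t) B (f t) (u t) =
      \sum_(s | side s) \sum_t E s t * B (f s) (f t).
    rewrite [RHS]exchange_big/= [LHS]big_mkcond/=; apply: eq_bigr => t _.
    case: ifPn => [nPt|/negPn Pt].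
      rewrite (ip_sumr psdB); apply: eq_bigr => s _.
      by rewrite (ipZr psdB) (ipC psdB).
    by rewrite big1// => s Ps; rewrite E0 ?mul0r// Ps Pt.
  rewrite (bigID side)/= -half mulr2n mulrDl mul1r; congr (_ + _).
  apply: eq_bigr => t nPt; rewrite (ip_sumr psdB) [RHS]big_mkcond/=.
  apply: eq_bigr => s _; rewrite (ipZr psdB) EC; case: ifPn => // nPs.
  by rewrite E0 ?mul0r// (negPf nPt) (negPf nPs).
have Su : \sum_(t | ~~ side t) u t = d *: TP.
  rewrite exchange_big/= scaler_sumr; apply: eq_bigr => s Ps.
  rewrite -scaler_suml -(ER s); congr (_ *: _); rewrite big_mkcond/=.
  by apply: eq_bigr => t _; case: ifPn => // /negPn Pt; rewrite E0// Ps Pt.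
have Suu : \sum_(t | ~~ side t) B (u t) (u t) =
    B TP TP + q%:R * \sum_(s | side s) B (f s) (f s).
  rewrite (eq_bigr (fun t => \sum_(s | side s) \sum_(s' | side s')
      E s t * E s' t * B (f s) (f s'))) => [|t _]; last first.
    rewrite (ip_suml psdB); apply: eq_bigr => s _.
    rewrite (ip_sumr psdB); apply: eq_bigr => s' _.
    by rewrite (ipZl psdB) (ipZr psdB) mulrA.
  rewrite exchange_big/= (ip_suml psdB) mulr_sumr -big_split/=.
  apply: eq_bigr => s Ps; rewrite exchange_big/= (ip_sumr psdB).
  rewrite [in RHS](eq_bigr (fun s' => 1 * B (f s) (f s'))) => [|s' _]; last first.
    by rewrite mul1r.
  have -> : q%:R * B (f s) (f s) = \sum_(s' | side s')
      (if s == s' then q%:R else 0) * B (f s) (f s').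
    rewrite (bigD1 s)//= eqxx big1 ?addr0// => s' /andP[_ ss'].
    by rewrite eq_sym (negPf ss') mul0r.
  rewrite -big_split/=; apply: eq_bigr => s' Ps'.
  by rewrite -mulrDl -EE// mulr_suml.
have AG : 2 * \sum_(t | ~~ side t) B (f t) (u t - a) <=
    r * (\sum_(t | ~~ side t) B (f t) (f t)) +
    (\sum_(t | ~~ side t) B (u t - a) (u t - a)) / r.
  rewrite !mulr_sumr mulr_suml -big_split/=.
  by apply: ler_sum => t _; exact: (ip_AMGM psdB).
have SLHS : \sum_(t | ~~ side t) B (f t) (u t - a) =
    \sum_(t | ~~ side t) B (f t) (u t) + d^-1 * B TP TP.
  under eq_bigr do rewrite (ipBr psdB).
  rewrite big_split/= sumrN -(ip_suml psdB) -/TL TLE /a (ipZr psdB) (ipNl psdB).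
  by rewrite mulrN opprK.
have SRHS : \sum_(t | ~~ side t) B (u t - a) (u t - a) =
    B TP TP + q%:R * (\sum_(s | side s) B (f s) (f s)) - 2 * B TP TP +
    (\sum_(t | ~~ side t) 1) * (d^-1 ^+ 2 * B TP TP).
  under eq_bigr do rewrite (ip_sqrB psdB).
  rewrite !big_split/= sumrN -mulr_sumr -(ip_suml psdB) Su Suu.
  rewrite (ipZl psdB) /a !(ipZr psdB) (ipZl psdB) mulrA mulfV ?gt_eqF// mul1r.
  by rewrite mulr_suml; congr (_ + _); apply: eq_bigr => t _; ring.
have TP0 := ip_ge0 psdB TP.
(* With this bound the coefficients of [B TP TP] in [SRHS] add up to at most [1 - 2 + 1 = 0]. What
   remains is [q] times the energy of the points, and dividing by [r] turns [q] into [r]. *)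
have bnd : (\sum_(t | ~~ side t) 1) * (d^-1 ^+ 2 * B TP TP) <= B TP TP.
  by rewrite mulrA ler_piMl// exprVn ler_pdivrMr ?exprn_gt0// mul1r.
rewrite lhs [in X in _ <= X](bigID side)/= mulrDr addrC.
rewrite SLHS SRHS mulrDr in AG.
move: AG bnd; set X := \sum_(_ | _) B _ (u _); set Y := \sum_(_ | _) B _ _.
set Z := \sum_(_ | side _) B _ _; set N := (\sum_(_ | _) 1) * _ => AG bnd.
have dT : 0 <= 2 * (d^-1 * B TP TP).
  by rewrite !mulr_ge0// invr_ge0 ltW.
have : (B TP TP + q%:R * Z - 2 * B TP TP + N) / r <= r * Z.
  by rewrite ler_pdivrMr// mulrAC -expr2 r2; lra.
move=> W; lra.
Qed.

(** Expanding the squares, the diagonal terms are controlled by regularity and the cross terms by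
    [plane_graph_form_le]. The factor [2] comes from summing over ordered pairs. *)
Lemma plane_graph_spectral_gap (f : T -> V) : \sum_s f s = 0 ->
  2 * (d - r) * \sum_s B (f s) (f s) <=
  \sum_s \sum_t E s t * B (f s - f t) (f s - f t).
Proof.
move=> /plane_graph_form_le h.
have -> : \sum_s \sum_t E s t * B (f s - f t) (f s - f t) =
   2 * d * (\sum_s B (f s) (f s)) - 2 * \sum_s \sum_t E s t * B (f s) (f t).
  have S1 : \sum_s \sum_t E s t * B (f s) (f s) = d * \sum_s B (f s) (f s).
    by rewrite mulr_sumr; apply: eq_bigr => s _; rewrite -mulr_suml ER.
  have S2 : \sum_s \sum_t E s t * B (f t) (f t) = d * \sum_s B (f s) (f s).
    rewrite exchange_big/= -S1; apply: eq_bigr => s _.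
    by apply: eq_bigr => t _; rewrite EC.
  rewrite -mulrA mulrDl mul1r -{1}S1 -S2 mulr_sumr -big_split -sumrB/=.
  apply: eq_bigr => s _; rewrite mulr_sumr -big_split -sumrB/=.
  by apply: eq_bigr => t _; rewrite (ip_sqrB psdB); ring.
rewrite mulrBr mulrBl lerB// -mulrA ler_pM2l//.
Qed.

End SpectralGap.

(** * The incidence graph of the subspaces of [F^3] is a [plane_graph] *)

Lemma dimv_add_line (K : fieldType) (vT : vectType K) (U : {vspace vT}) v :
  v \notin U -> \dim (U + <[v]>) = (\dim U).+1.
Proof.
move=> vU; apply/eqP; rewrite eqn_leq; apply/andP; split.
  apply: leq_trans (dimv_add_leqif U <[v]>).1 _.
  by rewrite -addn1 leq_add2l dim_vline leq_b1.
rewrite ltn_neqAle (dimv_leqif_sup (addvSl U _)).1 andbT.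
by rewrite (dimv_leqif_sup (addvSl U _)).2 subv_add subvv/= -memvE.
Qed.

Lemma eq_vspace_dim (K : fieldType) (vT : vectType K) (U W : {vspace vT}) :
  (U <= W)%VS -> \dim U = \dim W -> U = W.
Proof.
move=> UW dUW; apply/eqP; have := (dimv_leqif_eq UW).2.
by rewrite dUW eqxx => <-.
Qed.

Section VspacePlane.
Variables (F : finFieldType) (T : finType) (e : rel T).
Let V := 'rV[F]_3.
Implicit Types (U W : {vspace V}) (v : V).

Lemma card_vspace_diff U W : (U <= W)%VS ->
  (\sum_(v : V) ((v \in W) && (v \notin U)))%N = (#|F| ^ \dim W - #|F| ^ \dim U)%N.
Proof.
move=> UW; apply/eqP; rewrite -(eqn_add2r (#|F| ^ \dim U)).
have UWd : (#|F| ^ \dim U <= #|F| ^ \dim W)%N.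
  by rewrite leq_pexp2l ?dimvS//; apply/card_gt0P; exists 0.
rewrite subnK// -!card_vspace -!sum1_card [in eqbRHS]big_mkcond/=.
rewrite [X in (_ + X)%N]big_mkcond/= -big_split/=.
apply/eqP/eq_bigr => v _; have := subvP UW v.
by case: (v \in U) => [->//|_]; case: (v \in W).
Qed.

Variable w : T -> {vspace V}.
Hypotheses (w_inj : injective w).
Hypothesis w_dim : forall t, \dim (w t) = 1%N \/ \dim (w t) = 2%N.
Hypothesis w_surj : forall U, \dim U = 1%N \/ \dim U = 2%N -> exists t, w t = U.
Hypothesis eE : forall s t, e s t =
  (\dim (w s) != \dim (w t)) && ((w s <= w t)%VS || (w t <= w s)%VS).

Let side t := \dim (w t) == 1%N.

Let side1 t : side t -> \dim (w t) = 1%N. Proof. exact: eqP. Qed.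

Let side2 t : ~~ side t -> \dim (w t) = 2%N.
Proof. by rewrite /side; case: (w_dim t) => ->. Qed.

Let e12 s t : side s -> e s t = ~~ side t && (w s <= w t)%VS.
Proof.
move=> s1; rewrite eE (side1 s1); case: (boolP (side t)) => [/side1->//|t2].
rewrite (side2 t2)/=; case: (boolP (w t <= w s)%VS) => [/dimvS|]; last by rewrite orbF.
by rewrite (side1 s1) (side2 t2).
Qed.

Let eC : symmetric e.
Proof. by move=> s t; rewrite !eE eq_sym orbC. Qed.

Let sum_unique (P : pred T) t0 : (forall t, P t = (t == t0)) ->
  (\sum_t P t)%N = 1%N.
Proof.
move=> PE; rewrite (bigD1 t0)//= PE eqxx big1// => t tt0.
by rewrite PE (negPf tt0).
Qed.

Let eline s U : side s -> (w s <= U)%VS -> \dim U = 2%N ->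
  exists t0, forall t, [&& e s t & (U <= w t)%VS] = (t == t0).
Proof.
move=> s1 sU dU; have [t0 t0U] := w_surj (or_intror dU).
exists t0 => t; rewrite e12//; apply/idP/eqP => [|->]; last first.
  by rewrite /side t0U dU sU subvv.
move=> /andP[/andP[t2 _] Ut]; apply: w_inj; rewrite t0U.
by apply/esym/eq_vspace_dim; rewrite // dU side2.
Qed.

(** Degrees come from counting vectors: the planes of [F^3] through a line partition the vectors
    outside it, and the lines in a plane partition its nonzero vectors. So the degrees are
    [(q^3 - q) / (q^2 - q)] and [(q^2 - 1) / (q - 1)], both [q + 1]. *)
Lemma vspace_plane_graph : plane_graph e side #|F|.
Proof.
have F1 : (1 < #|F|)%N := finNzRing_gt1 F.
split=> //.
- move=> s t; rewrite eE /side.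
  by case: (w_dim s) (w_dim t) => [->|->] [->|->].
- move=> s; case: (boolP (side s)) => [s1|s2].
    have : (\sum_t e s t * (#|F| ^ 2 - #|F|))%N = (#|F| ^ 3 - #|F|)%N.
      rewrite (eq_bigr (fun t => \sum_(v : V)
          (e s t && (v \in w t)) && (v \notin w s))%N) => [|t _]; last first.
        case: (boolP (e s t)) => [|_]; last by rewrite mul0n big1.
        rewrite mul1n e12// => /andP[/side2 t2 st].
        by rewrite card_vspace_diff// t2 side1.
      rewrite exchange_big/=.
      have := card_vspace_diff (subvf (w s)); rewrite dimvf (side1 s1) => <-.
      apply: eq_bigr => v _; rewrite memvf/=.
      case: (boolP (v \in w s)) => vs; first by rewrite big1// => t _; rewrite andbF.
      have [|t0 t0P] := eline s1 (addvSl (w s) <[v]>).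
        by rewrite dimv_add_line// side1.
      apply: (@sum_unique _ t0) => t; rewrite andbT -t0P.
      case: (boolP (e s t)) => //=; rewrite e12// => /andP[_ st].
      by rewrite subv_add st -memvE.
    rewrite -big_distrl/= => h; apply/eqP.
    have p : (0 < #|F| ^ 2 - #|F|)%N by rewrite subn_gt0 -{1}[#|F|]expn1 ltn_exp2l.
    rewrite -(eqn_pmul2r p) h; move: (#|F|) F1 {h p} => m m1.
    by have [k ->] : exists k, m = k.+1; [exists m.-1; lia | rewrite !expnS; nia].
  have : (\sum_t e s t * (#|F| - 1))%N = (#|F| ^ 2 - 1)%N.
    rewrite (eq_bigr (fun t => \sum_(v : V)
        (e s t && (v \in w t)) && (v \notin 0%VS))%N) => [|t _]; last first.
      case: (boolP (e s t)) => [|_]; last by rewrite mul0n big1.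
      rewrite mul1n => est; have t1 : side t.
        by move: est; rewrite eE (side2 s2) /side; case: (w_dim t) => ->.
      by rewrite card_vspace_diff ?sub0v// dimv0 side1.
    rewrite exchange_big/=.
    have := card_vspace_diff (sub0v (w s)); rewrite dimv0 (side2 s2) => <-.
    apply: eq_bigr => v _; rewrite memv0.
    have [->|v0] := eqVneq v 0; first by rewrite andbF big1// => t _; rewrite andbF.
    rewrite andbT; case: (boolP (v \in w s)) => vs; last first.
      rewrite big1// => t _; rewrite andbT; case: (boolP (e s t)) => //.
      rewrite eE (side2 s2) => /andP[t1 /orP[|/subvP /(_ v)]].
        by move=> /dimvS; rewrite (side2 s2); case: (w_dim t) t1 => ->.
      by case: (v \in w t) => // /(_ isT); rewrite (negPf vs).
    have [|t0 t0P] := w_surj (U := <[v]>); first by left; rewrite dim_vline v0.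
    apply: (@sum_unique _ t0) => t; rewrite andbT; apply/idP/eqP => [|->].
      move=> /andP[est vt]; apply: w_inj; rewrite t0P; apply/esym/eq_vspace_dim.
        by rewrite -memvE.
      rewrite dim_vline v0; move: est; rewrite eE (side2 s2).
      by case: (w_dim t) => ->.
    by rewrite eE t0P dim_vline v0 (side2 s2) memv_line -memvE vs orbT.
  rewrite -big_distrl/= => h; apply/eqP.
  have p : (0 < #|F| - 1)%N by rewrite subn_gt0.
  rewrite -(eqn_pmul2r p) h; move: (#|F|) F1 {h p} => m m1; rewrite !expnS; nia.
- move=> s s' s1 s'1 ss'.
  (* The sum of two distinct points is the only line containing both. *)
  have d2 : \dim (w s + w s')%VS = 2%N.
    apply/eqP; rewrite eqn_leq; apply/andP; split.
      by apply: leq_trans (dimv_add_leqif _ _).1 _; rewrite !side1.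
    have := (dimv_leqif_sup (addvSl (w s) (w s'))).
    rewrite side1// => -[]; rewrite leq_eqVlt => /orP[/eqP eq1|//].
    rewrite -eq1 eqxx => /esym; rewrite subv_add subvv/= => s's.
    by case/eqP: ss'; apply: w_inj; apply/esym/eq_vspace_dim; rewrite ?side1.
  have [t0 t0P] := eline s1 (addvSl _ _) d2.
  rewrite (eq_bigr (fun t => nat_of_bool (e s t && e s' t))) => [|t _]; last first.
    by case: (e s t); case: (e s' t).
  apply: (@sum_unique _ t0) => t; rewrite -t0P !e12// subv_add.
  by case: (side t); case: (w s <= w t)%VS.
Qed.

End VspacePlane.

Lemma incidence_plane_graph (F : finFieldType) (T : finType) (e : rel T) :
  graph_isomorphic e (@incidence_graph F) -> exists side, plane_graph e side #|F|.
Proof.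
move=> [f [g fK gK] fE].
(* Forgetting the tag loses nothing, since the dimension tells points from lines. *)
pose c (x : Defs.point F + line F) :=
  match x with inl p => val p | inr l => val l end.
have cI : injective c.
  move=> [[p hp]|[l hl]] [[p' hp']|[l' hl']] /= h.
  - by congr inl; apply: val_inj.
  - by exfalso; move: hl'; rewrite -h (eqP hp).
  - by exfalso; move: hl; rewrite h (eqP hp').
  - by congr inr; apply: val_inj.
exists (fun t => \dim (c (f t)) == 1%N).
apply: (vspace_plane_graph (w := c \o f)) => [s t /cI /(can_inj fK)//|t|U|s t] /=.
- by case: (f t) => [[p /eqP]|[l /eqP]] /=; [left|right].
- case=> /eqP hU.
    by exists (g (inl (exist _ U hU))); rewrite gK.
  by exists (g (inr (exist _ U hU))); rewrite gK.
- rewrite -fE; case: (f s) (f t) => [[p hp]|[l hl]] [[p' hp']|[l' hl']] /=.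
  + by rewrite (eqP hp) (eqP hp').
  + rewrite (eqP hp) (eqP hl') /incident/=.
    by case: (boolP (l' <= p)%VS) => [/dimvS|]; rewrite ?(eqP hp) ?(eqP hl') ?orbF.
  + rewrite (eqP hl) (eqP hp') /incident/=.
    by case: (boolP (l <= p')%VS) => [/dimvS|]; rewrite ?(eqP hl) ?(eqP hp').
  + by rewrite (eqP hl) (eqP hl').
Qed.

(** * Limits for a form, adjoints, and forms on finite families *)

Section FormConvergence.
Variables (R : realType) (V : lmodType R) (B : V -> V -> R).
Hypothesis psdB : psd_form B.
Implicit Types (u v : nat -> V) (l k : V).

Lemma form_cvgD u v l k : form_cvg B u l -> form_cvg B v k ->
  form_cvg B (fun n => u n + v n) (l + k).
Proof.
(* Squared norms satisfy [|x + y|^2 <= 2 |x|^2 + 2 |y|^2], hence a quarter of [e] for each term. *)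
move=> ul vk e e0; have e4 : 0 < e / 4 by rewrite divr_gt0.
have [N hN] := ul _ e4; have [M hM] := vk _ e4.
exists (maxn N M) => n; rewrite geq_max => /andP[/hN hn /hM hm].
rewrite opprD addrACA; move: hn hm; move: (u n - l) (v n - k) => x y hx hy.
have := ip_ge0 psdB (x - y); rewrite (ip_sqrB psdB) (ip_sqrD psdB) => *; lra.
Qed.

Lemma form_cvg_lipschitz (phi : V -> V) K u l :
  {morph phi : x y / x - y} -> (forall x, B (phi x) (phi x) <= K * B x x) ->
  form_cvg B u l -> form_cvg B (phi \o u) (phi l).
Proof.
move=> phiB phiK ul e e0; have K0 : 0 < `|K| + 1 by rewrite ltr_wpDl.
have [N hN] := ul _ (divr_gt0 e0 K0); exists N => n /hN.
rewrite ltr_pdivlMr//= -phiB => /(le_lt_trans _); apply.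
apply: le_trans (phiK _) _; rewrite mulrC ler_wpM2l ?(ip_ge0 psdB)//.
by apply: le_trans (ler_norm _) _; rewrite lerDl.
Qed.

Lemma form_cvgN u l : form_cvg B u l -> form_cvg B (fun n => - u n) (- l).
Proof.
apply: (@form_cvg_lipschitz -%R 1) => [x y|x]; first exact: opprD.
by rewrite (ipNl psdB) (ipNr psdB) opprK mul1r.
Qed.

Lemma form_cvg_sum (I : finType) (u : nat -> I -> V) (l : I -> V) :
  (forall i, form_cvg B (u^~ i) (l i)) ->
  form_cvg B (fun n => \sum_i u n i) (\sum_i l i).
Proof.
move=> ul; elim: (index_enum I) => [|i s IHs].
  by move=> e e0; exists 0%N => n _; rewrite !big_nil subrr (ip0l psdB).
move=> e e0; have [N hN] := form_cvgD (ul i) IHs e0.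
by exists N => n /hN; rewrite !big_cons.
Qed.

Hypothesis defB : forall x, B x x = 0 -> x = 0.

(** Serves to pass linear identities to the limit, applied to the difference of the two sides. *)
Lemma form_cvg_eq0 u l : (forall n, u n = 0) -> form_cvg B u l -> l = 0.
Proof.
move=> u0 ul; apply: defB; apply/eqP; rewrite eq_le (ip_ge0 psdB) andbT.
apply/ler_addgt0Pr => e e0; rewrite add0r; have [N /(_ N (leqnn _))] := ul _ e0.
by rewrite u0 sub0r (ipNl psdB) (ipNr psdB) opprK => /ltW.
Qed.

Lemma form_inj x y : (forall z, B z x = B z y) -> x = y.
Proof.
move=> h; apply/subr0_eq/defB; by rewrite (ipBr psdB) h subrr.
Qed.

(** Riesz represents [x |-> B (phi x) y] for each [y], and choice collects the representing
    vectors. *)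
Lemma adjoint_exists (phi : V -> V) K : form_complete B (fun=> True) ->
  (forall a x y, phi (a *: x + y) = a *: phi x + phi y) ->
  (forall x, B (phi x) (phi x) <= K * B x x) ->
  exists phi' : V -> V, forall x y, B (phi x) y = B x (phi' y).
Proof.
move=> complB phiP phiK.
suff /choice[phi' phi'P] y : exists y', forall x, B (phi x) y = B x y'.
  by exists phi'.
have [|||c _ hc] := @riesz_representation _ _ B psdB (fun=> True)
  (fun x => B (phi x) y) (K * B y y) _ complB; first by [].
- by move=> a x z; rewrite phiP (ipPl psdB).
- move=> x _; apply: le_trans (ip_CauchySchwarz psdB _ _) _.
  by rewrite mulrAC ler_wpM2r ?phiK// ip_ge0.
- by exists c => x; rewrite hc// (ipC psdB).
Qed.

End FormConvergence.

Lemma psd_form_sum (R : realType) (V : lmodType R) (B : V -> V -> R)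
    (I : finType) : psd_form B ->
  psd_form (fun c c' : {ffun I -> V} => \sum_i B (c i) (c' i)).
Proof.
move=> psdB; split=> [c c'|a x y z|c].
- by apply: eq_bigr => i _; rewrite (ipC psdB).
- rewrite mulr_sumr -big_split/=; apply: eq_bigr => i _.
  by rewrite !ffunE (ipPl psdB).
- by apply: sumr_ge0 => i _; exact: ip_ge0.
Qed.

(** On link cocycles this form will dominate a positive multiple of the one in [psd_form_sum], by
    [link_cocycle_sum_bound]. *)
Lemma psd_form_of_sum (R : realType) (V : lmodType R) (B : V -> V -> R)
    (I : finType) : psd_form B ->
  psd_form (fun c c' : {ffun I -> V} => B (\sum_i c i) (\sum_i c' i)).
Proof.
move=> psdB; split=> [c c'|a x y z|c]; [exact: ipC | | exact: ip_ge0].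
rewrite -(ipPl psdB) scaler_sumr -big_split/=; congr (B _ _).
by apply: eq_bigr => i _; rewrite !ffunE.
Qed.

(** * Cocycles restricted to the generating set, and vanishing of their cohomology *)

Section LinkCocycles.
Variables (R : realType) (V : lmodType R) (B : V -> V -> R).
Hypotheses (psdB : psd_form B) (defB : forall x, B x x = 0 -> x = 0).
Hypothesis complB : form_complete B (fun=> True).
Variables (G : groupType) (S : {fset G}).
Hypothesis SV : forall s, s \in S -> (s^-1)%g \in S.

Let T : finType := S.

(** [K] bounds squared norms. The operators are bare functions because the contragredient arises by
    choice, its linearity being proved afterwards. *)
Record bounded_rep (K : R) (rho : G -> V -> V) : Prop := BoundedRep {
  brP : forall g a x y, rho g (a *: x + y) = a *: rho g x + rho g y;
  brM : forall g h x, rho (g * h)%g x = rho g (rho h x);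
  br1 : forall x, rho 1%g x = x;
  br_le : forall g x, B (rho g x) (rho g x) <= K * B x x
}.

(** The instances of the cocycle identity that stay inside [S], and those for [s^-1 * s = 1], where
    the value at [1] is zero. A cocycle is thus a point of a finite power of [V]. *)
Definition link_cocycle (rho : G -> V -> V) (c : {ffun T -> V}) : Prop :=
  (forall s t u : T, (val s * val u)%g = val t -> c t - c s = rho (val s) (c u))
  /\ (forall s t : T, val t = (val s)^-1%g -> rho (val t) (c s) = - c t).

Definition link_coboundary (rho : G -> V -> V) (v : V) : {ffun T -> V} :=
  [ffun s => v - rho (val s) v].

Let sinv (s : T) : T := FSetSub (SV (fsvalP s)).

Let sinvK : involutive sinv.
Proof. by move=> s; apply: val_inj; rewrite /= invgK. Qed.

Section BoundedRep.
Variables (K : R) (rho : G -> V -> V).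
Hypothesis rhoK : bounded_rep K rho.

Lemma br0 g : rho g 0 = 0.
Proof.
have := brP rhoK g 1 0 0; rewrite !scale1r !addr0 => /esym/eqP.
by rewrite -subr_eq0 addrK => /eqP.
Qed.

Lemma brB g x y : rho g (x - y) = rho g x - rho g y.
Proof. by rewrite addrC -scaleN1r (brP rhoK) scaleN1r addrC. Qed.

Lemma link_cocycle_subspace : subspace (link_cocycle rho).
Proof.
split=> [|a x y [x1 x2] [y1 y2]].
  by split=> [s t u|s t] _; rewrite !ffunE br0 ?subrr ?oppr0.
split=> [s t u stu|s t st]; rewrite !ffunE (brP rhoK).
  by rewrite -(x1 s t u stu) -(y1 s t u stu) opprD addrACA -scalerBr.
by rewrite (x2 s t st) (y2 s t st) opprD scalerN.
Qed.

Lemma link_coboundaryP v : link_cocycle rho (link_coboundary rho v).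
Proof.
split=> [s t u stu|s t st]; rewrite !ffunE brB.
  by rewrite -(brM rhoK) stu opprB addrC subrKA.
by rewrite -(brM rhoK) st mulVg (br1 rhoK) opprB.
Qed.

End BoundedRep.

Definition dual_reps (rho sigma : G -> V -> V) :=
  forall g x y, B (rho g^-1%g x) y = B x (sigma g y).

Lemma dual_reps_sym rho sigma : dual_reps rho sigma -> dual_reps sigma rho.
Proof. by move=> h g x y; rewrite (ipC psdB) -h invgK (ipC psdB). Qed.

(** [sigma g] is the adjoint of [rho g^-1]. The laws of a representation carry over by nondegeneracy
    of [B], and an adjoint obeys the same norm bound. *)
Lemma contragredient K rho : bounded_rep K rho ->
  exists2 sigma, bounded_rep K sigma & dual_reps rho sigma.
Proof.
move=> rhoK.
have /choice[sigma dual] g : exists phi' : V -> V,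
    forall x y, B (rho g^-1%g x) y = B x (phi' y).
  apply: (adjoint_exists psdB complB) (br_le rhoK _).
  exact: (brP rhoK).
exists sigma => //; split=> [g a x y|g h x|x|g x].
- apply: (form_inj psdB defB) => z.
  by rewrite -dual !(ipDr psdB) !(ipZr psdB) -!dual.
- by apply: (form_inj psdB defB) => z; rewrite -!dual invgM (brM rhoK).
- by apply: (form_inj psdB defB) => z; rewrite -dual invg1 (br1 rhoK).
- have /predU1P[s0|s0] : (0 == B (sigma g x) (sigma g x)) || (0 < B (sigma g x) (sigma g x)).
    by rewrite -le_eqVlt ip_ge0.
    by rewrite -s0; apply: le_trans (br_le rhoK g x); exact: ip_ge0.
  (* This reads [|sigma x|^4 <= K |sigma x|^2 |x|^2], to be divided by [|sigma x|^2]. *)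
  have := ip_CauchySchwarz psdB (rho g^-1%g (sigma g x)) x.
  rewrite dual expr2 => h; rewrite -(ler_pM2l s0); apply: le_trans h _.
  by rewrite mulrA ler_wpM2r ?(ip_ge0 psdB)// mulrC; exact: br_le.
Qed.

(* The adjoint of the coboundary map is twice the sum over [S]. *)
Lemma link_coboundary_adjoint rho sigma v c :
    dual_reps rho sigma -> link_cocycle sigma c ->
  \sum_s B (link_coboundary rho v s) (c s) = 2 * B v (\sum_s c s).
Proof.
move=> dual [_ c2]; rewrite mulr2n mulrDl mul1r (ip_sumr psdB).
(* The second copy of the sum runs over inverses, to match [sigma s^-1 (c s) = - c s^-1]. *)
rewrite [X in _ = _ + X](reindex_inj (inv_inj sinvK))/= -big_split/=.
apply: eq_bigr => s _; rewrite ffunE (ipBl psdB) -[val s in LHS]invgK dual.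
by rewrite (c2 s (sinv s) erefl) (ipNr psdB) opprK.
Qed.

Variables (side : pred T) (q : nat).
Hypotheses (pgS : plane_graph (@link_graph G S) side q) (q_gt0 : (0 < q)%N).

Let d : R := q%:R + 1.
Let r : R := Num.sqrt q%:R.

Let E (s t : T) : R := (link_graph s t)%:R.

Let tri (s u t : T) : bool := (val s * val u)%g == val t.

Let sum_val (z : G) : \sum_(u : T) (val u == z)%:R = (z \in S)%:R :> R.
Proof.
case: (boolP (z \in S)) => zS; last first.
  rewrite big1// => u _; case: eqP => // uz.
  by rewrite -uz (fsvalP u) in zS.
rewrite (bigD1 (FSetSub zS))//= eqxx big1 ?addr0// => u; rewrite -val_eqE/=.
by move=> /negPf ->.
Qed.

Let triE s t : \sum_u (tri s u t)%:R = E s t.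
Proof.
rewrite /E /link_graph -sum_val; apply: eq_bigr => u _; congr (nat_of_bool _)%:R.
by apply/eqP/eqP => [<-|->]; rewrite ?mulKg ?mulVKg.
Qed.

(** After replacing [s] by its inverse, the triangles [s * u = t] become the edges of the link at
    [u]. *)
Let tri_deg u : \sum_s \sum_t (tri s u t)%:R = d.
Proof.
rewrite (reindex_inj (inv_inj sinvK))/=.
rewrite (eq_bigr (fun s => E u s)) => [|s _].
  by rewrite -natr_sum (pg_deg pgS) mulrSr.
rewrite /E (pg_sym pgS) /link_graph -sum_val; apply: eq_bigr => t _.
by rewrite /tri eq_sym.
Qed.

Lemma link_cocycle_energy K rho (c : {ffun T -> V}) :
    bounded_rep K rho -> link_cocycle rho c ->
  \sum_s \sum_t E s t * B (c s - c t) (c s - c t) <=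
  K * d * \sum_u B (c u) (c u).
Proof.
move=> rhoK [c1 _].
have -> : K * d * (\sum_u B (c u) (c u)) =
    \sum_s \sum_t \sum_u (tri s u t)%:R * (K * B (c u) (c u)).
  under [RHS]eq_bigr do rewrite exchange_big/=.
  rewrite exchange_big/= mulr_sumr; apply: eq_bigr => u _.
  under [RHS]eq_bigr do rewrite -mulr_suml.
  by rewrite -mulr_suml tri_deg; ring.
apply: ler_sum => s _; apply: ler_sum => t _; rewrite -triE mulr_suml.
apply: ler_sum => u _; rewrite /tri; case: eqP => [stu|_]; last by rewrite !mul0r.
rewrite !mul1r -opprB (ipNl psdB) (ipNr psdB) opprK (c1 _ _ _ stu).
exact: br_le.
Qed.

(** The spectral gap is applied to [c] minus its mean [mu] and compared with [link_cocycle_energy].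
    As [kappa] does not depend on [rho], it serves a representation and its contragredient alike. *)
Lemma link_cocycle_sum_bound K : K * d < 2 * (d - r) ->
  exists2 kappa, 0 < kappa & forall rho c, bounded_rep K rho ->
    link_cocycle rho c ->
    kappa * \sum_s B (c s) (c s) <= B (\sum_s c s) (\sum_s c s).
Proof.
move=> Kd; have [T0|Tn0] := eqVneq #|T| 0%N.
  exists 1 => // rho c _ _; rewrite big1 ?mulr0 ?(ip_ge0 psdB)// => s _.
  by have := fintype0 s T0.
have dr : 0 < d - r.
  have <- : r ^+ 2 + 1 = d by rewrite sqr_sqrtr.
  have := sqr_ge0 (2 * r - 1); have := sqr_ge0 r => *; lra.
have m0 : 0 < #|T|%:R :> R by rewrite ltr0n lt0n.
(* Found by solving [2 * (d - r) * (X - Y / #|T|) <= K * d * X] for [Y], where [X] is the sum of the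
   squared norms and [Y] the squared norm of the sum. *)
exists ((2 * (d - r) - K * d) * #|T|%:R / (2 * (d - r))).
  by rewrite divr_gt0 ?mulr_gt0// subr_gt0.
move=> rho c rhoK cZ; set TT := \sum_s c s.
pose mu := #|T|%:R^-1 *: TT.
have f0 : \sum_s (c s - mu) = 0.
  rewrite sumrB -/TT sumr_const /mu -scaler_nat scalerA mulfV ?gt_eqF//.
  by rewrite scale1r subrr.
have := plane_graph_spectral_gap psdB pgS q_gt0 f0; rewrite -/d -/r.
have -> : \sum_s B (c s - mu) (c s - mu) =
    \sum_s B (c s) (c s) - #|T|%:R^-1 * B TT TT.
  under eq_bigr do rewrite (ip_sqrB psdB).
  rewrite big_split sumrB/= -mulr_sumr -(ip_suml psdB) -/TT sumr_const.
  rewrite -[_ *+ _]mulr_natl /mu !(ipZr psdB) (ipZl psdB).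
  by field; rewrite gt_eqF.
under [leRHS]eq_bigr => s _ do under eq_bigr => t _ do rewrite opprB addrA subrK.
move=> /le_trans /(_ (link_cocycle_energy rhoK cZ)) h.
have dr2 : 0 < 2 * (d - r) by rewrite mulr_gt0.
rewrite -(ler_pM2l m0) in h; rewrite mulrAC ler_pdivrMr//.
have hE X Y : #|T|%:R * (2 * (d - r) * (X - #|T|%:R^-1 * Y)) =
    2 * (d - r) * #|T|%:R * X - 2 * (d - r) * Y by field; rewrite gt_eqF.
rewrite hE in h; lra.
Qed.

Lemma link_cocycle_coboundary K pi b : K * d < 2 * (d - r) ->
  bounded_rep K pi -> link_cocycle pi b ->
  exists v, b = link_coboundary pi v.
Proof.
move=> Kd piK bZ; have [kappa kappa0 kappaP] := link_cocycle_sum_bound Kd.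
have [sigma sigmaK dual] := contragredient piK.
have subsigma := link_cocycle_subspace sigmaK.
have psdS := psd_form_sum T psdB; have psdT := psd_form_of_sum T psdB.
(* By [kappaP], a sequence of cocycles that is Cauchy for the sum form is Cauchy in each coordinate;
   the coordinatewise limit is again a cocycle because [sigma] is continuous. *)
have compl : form_complete (fun c c' : {ffun T -> V} =>
    B (\sum_i c i) (\sum_i c' i)) (link_cocycle sigma).
  move=> u uZ uC.
  have /choice[l lP] (s : T) : exists l, form_cvg B (fun n => u n s) l.
    have [|e e0|l _ ?] := complB (u := fun n => u n s); [by []| |by exists l].
    have [N hN] := uC _ (mulr_gt0 kappa0 e0); exists N => m n hm hn.
    have uZB : link_cocycle sigma (u m - u n).
      rewrite addrC -scaleN1r; apply: (subsigma.2); exact: uZ.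
    rewrite -(ltr_pM2l kappa0); apply: le_lt_trans (hN _ _ hm hn).
    apply: le_trans (kappaP _ _ sigmaK uZB); rewrite ler_pM2l// (bigD1 s)//= !ffunE.
    by rewrite lerDl; apply: sumr_ge0 => i _; exact: ip_ge0.
  have sl g s := form_cvg_lipschitz psdB (brB sigmaK g) (br_le sigmaK g) (lP s).
  exists (finfun l).
    split=> [s t w stw|s t st]; rewrite !ffunE; apply: subr0_eq.
      have := form_cvgD psdB (form_cvgD psdB (lP t) (form_cvgN psdB (lP s)))
        (form_cvgN psdB (sl (val s) w)).
      by apply: (form_cvg_eq0 psdB defB) => n; rewrite ((uZ n).1 s t w stw) subrr.
    have := form_cvgD psdB (sl (val t) s) (form_cvgN psdB (form_cvgN psdB (lP t))).
    by apply: (form_cvg_eq0 psdB defB) => n /=; rewrite ((uZ n).2 s t st) opprK addNr.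
  move=> e e0; have [N hN] := form_cvg_sum psdB lP e0; exists N => n /hN.
  by rewrite -sumrB; under [in X in _ -> X]eq_bigr do rewrite !ffunE.
have [||c0 c0Z c0P] := riesz_representation psdT
    (phi := fun c : {ffun T -> V} => \sum_s B (b s) (c s))
    (K := kappa^-1 * \sum_s B (b s) (b s)) subsigma compl.
- move=> a x y; rewrite mulr_sumr -big_split/=; apply: eq_bigr => s _.
  by rewrite !ffunE (ipDr psdB) (ipZr psdB).
- move=> x xZ; apply: le_trans (ip_CauchySchwarz psdS b x) _.
  rewrite mulrAC [leRHS]mulrC; apply: ler_wpM2l; first exact: (ip_ge0 psdS b).
  by rewrite -ler_pdivrMl ?invr_gt0// invrK; exact: kappaP xZ.
(* The half cancels the [2] of [link_coboundary_adjoint], so the coboundary of [v] pairs with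
   cocycles of [sigma] as [b] does. *)
pose v := 2^-1 *: \sum_s c0 s; exists v.
pose b0 := b - link_coboundary pi v.
have b0Z : link_cocycle pi b0.
  rewrite /b0 addrC -scaleN1r; apply: (link_cocycle_subspace piK).2 => //.
  exact: link_coboundaryP piK v.
have b0_orth c : link_cocycle sigma c -> \sum_s B (b0 s) (c s) = 0.
  move=> cZ; rewrite (eq_bigr (fun s => B (b s) (c s) -
    B (link_coboundary pi v s) (c s))) => [|s _]; last first.
    by rewrite -(ipBl psdB) /b0 !ffunE.
  rewrite sumrB (c0P _ cZ) (link_coboundary_adjoint _ dual cZ) (ipZl psdB).
  by field.
(* The adjunction is used with [pi] and [sigma] exchanged, on the coboundary of an arbitrary [w]. *)
have b0_sum : \sum_s b0 s = 0.
  apply: (form_inj psdB defB) => w; rewrite (ip0r psdB).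
  have := b0_orth _ (link_coboundaryP sigmaK w).
  under eq_bigr do rewrite (ipC psdB).
  rewrite (link_coboundary_adjoint _ (dual_reps_sym dual) b0Z) => /eqP.
  by rewrite mulf_eq0 pnatr_eq0/= => /eqP.
have := kappaP _ _ piK b0Z; rewrite b0_sum (ip0l psdB) pmulr_rle0// => le0.
apply/subr0_eq/ffunP => s; rewrite -/b0 [RHS]ffunE; apply: defB.
apply/eqP; rewrite eq_le (ip_ge0 psdB) andbT; apply: le_trans le0.
rewrite (bigD1 s)//= lerDl; apply: sumr_ge0 => i _; exact: ip_ge0.
Qed.

End LinkCocycles.

(** * Real and complex Hilbert spaces seen as real ones *)

Section Scalars.
Variables (R : realType) (k : scalars).
Implicit Types (a : R) (z : scalar_field R k).

Definition of_real : R -> scalar_field R k :=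
  match k with
  | RealScalars => fun x => x
  | ComplexScalars => real_complex R
  end.

Lemma of_realD : {morph of_real : a b / a + b}.
Proof. by rewrite /of_real; case: k => //=; exact: rmorphD. Qed.

Lemma of_realM : {morph of_real : a b / a * b}.
Proof. by rewrite /of_real; case: k => //=; exact: rmorphM. Qed.

Lemma of_real1 : of_real 1 = 1.
Proof. by rewrite /of_real; case: k. Qed.

Lemma scalar_reD z z' : scalar_re (z + z') = scalar_re z + scalar_re z'.
Proof. by case: k z z' => //= -[? ?] [? ?]. Qed.

Lemma scalar_re_of_realM a z : scalar_re (of_real a * z) = a * scalar_re z.
Proof.
rewrite /of_real; case: k z => //= -[x y] /=.
by rewrite mul0r subr0.
Qed.

Lemma scalar_re_conj z : scalar_re (scalar_conj z) = scalar_re z.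
Proof. by case: k z => //= -[x y]. Qed.

(** In the order of [R[i]], a nonnegative number has zero imaginary part. *)
Lemma ge0_of_real z : 0 <= z -> of_real (scalar_re z) = z.
Proof.
rewrite /of_real; case: k z => //= -[x y].
by rewrite lecE/= => /andP[/eqP-> _].
Qed.

Lemma ler_scalar_re z z' : z <= z' -> scalar_re z <= scalar_re z'.
Proof. by case: k z z' => //= -[? ?] [? ?]; rewrite lecE => /andP[]. Qed.

Lemma ltr_scalar_re z z' : z < z' -> scalar_re z < scalar_re z'.
Proof. by case: k z z' => //= -[? ?] [? ?]; rewrite ltcE => /andP[]. Qed.

Lemma ltr_of_real a b : (of_real a < of_real b) = (a < b).
Proof. by rewrite /of_real; case: k => //=; rewrite ltcR. Qed.

Lemma scalar_re0 : scalar_re (0 : scalar_field R k) = 0.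
Proof. by case: k. Qed.

End Scalars.

(* A type alias, so that the scaling by [R] does not clash with the one of
   [H] when the scalars are real. *)
Definition realified (R : realType) (k : scalars) (H : hilbertSpace R k) : Type := H.

Section Realified.
Variables (R : realType) (k : scalars) (H : hilbertSpace R k).
Local Notation V := (realified H).

HB.instance Definition _ := GRing.Zmodule.on V.

Let rscale (a : R) (x : V) : V := of_real k a *: (x : H).

Let rscaleA a b v : rscale a (rscale b v) = rscale (a * b) v.
Proof. by rewrite /rscale scalerA of_realM. Qed.

Let rscale1 : left_id 1 rscale.
Proof. by move=> x; rewrite /rscale of_real1 scale1r. Qed.

Let rscaleDr : right_distributive rscale +%R.
Proof. by move=> a x y; rewrite /rscale scalerDr. Qed.

Let rscaleDl v : {morph rscale^~ v : a b / a + b}.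
Proof. by move=> a b; rewrite /rscale of_realD scalerDl. Qed.

HB.instance Definition _ := GRing.Zmodule_isLmodule.Build R V
  rscaleA rscale1 rscaleDr rscaleDl.

Definition real_dot (x y : V) : R := scalar_re (hilbert_dot H x y).

Definition real_norm (x : V) : R := scalar_re `|x : H|.

Lemma real_norm_ge0 x : 0 <= real_norm x.
Proof. by rewrite -(scalar_re0 R k); apply/ler_scalar_re/normr_ge0. Qed.

Lemma of_real_norm x : of_real k (real_norm x) = `|x : H|.
Proof. exact: ge0_of_real. Qed.

Lemma real_dotE x : real_dot x x = real_norm x ^+ 2.
Proof.
by rewrite /real_dot hilbert_dotE expr2 -{1}of_real_norm scalar_re_of_realM.
Qed.

Lemma psd_real_dot : psd_form real_dot.
Proof.
split=> [x y|a x y z|x]; last by rewrite real_dotE sqr_ge0.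
  rewrite /real_dot -(scalar_re_conj (hilbert_dot H y x)).
  by rewrite (@hermitian_subproof _ _ _ _ (hilbert_dot H)) expr0 mul1r.
by rewrite /real_dot linearPl scalar_reD scalar_re_of_realM.
Qed.

Lemma real_dot_eq0 x : real_dot x x = 0 -> x = 0.
Proof.
move=> /eqP; rewrite real_dotE sqrf_eq0 => /eqP x0; apply/eqP.
by rewrite -(normr_eq0 (x : H)) -of_real_norm x0 -(scalar_re0 R k) ge0_of_real.
Qed.

Lemma real_norm_lt x (e : R) : 0 < e ->
  (real_dot x x < e ^+ 2) = (`|x : H| < of_real k e).
Proof.
move=> e0; rewrite real_dotE ltr_pXn2r ?nnegrE ?real_norm_ge0 ?ltW//.
by rewrite -of_real_norm ltr_of_real.
Qed.

Lemma real_dot_complete : form_complete real_dot (fun=> True).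
Proof.
move=> u _ uC; pose F := ((u : nat -> H) @ \oo)%classic.
have Fc : cauchy F.
  apply/cauchy_ballP => e e0; have e'0 := ltr_scalar_re e0.
  rewrite scalar_re0 in e'0; have [N hN] := uC _ (exprn_gt0 2 e'0).
  pose tail : set H := [set x | exists2 n, (N <= n)%N & x = u n]%classic.
  exists (tail, tail).
    by split; exists N => // n Nn; exists n.
  move=> [x y] /= [[m Nm ->] [n Nn ->]].
  rewrite -ball_normE/= -(ge0_of_real (ltW e0)) -real_norm_lt//.
  exact: hN.
have [l Fl] : exists l : H, (F --> l)%classic by exact/cvg_ex/(cauchy_cvg F Fc).
(* The square root converts the bound [e] on squared norms into one on norms. *)
exists l => // e e0; have se0 : 0 < Num.sqrt e by rewrite sqrtr_gt0.
have [] := ((cvgrPdistC_lt _ _).1 Fl) (of_real k (Num.sqrt e)).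
  by rewrite -[X in X < _](ge0_of_real (lexx 0)) ltr_of_real scalar_re0.
move=> N _ hN; exists N => n /hN /=; rewrite -real_norm_lt// sqr_sqrtr//.
exact: ltW.
Qed.

End Realified.

Lemma opnorm_real_norm (R : realType) (k : scalars) (H : hilbertSpace R k)
    (f : {linear H -> H}) (C : R) : (opnorm f <= C%:E)%E ->
  forall x : realified H, real_norm (f x : realified H) <= C * real_norm x.
Proof.
move=> fC x; have [->|x0] := eqVneq (x : H) 0.
  by rewrite linear0 /real_norm normr0 scalar_re0 mulr0.
have nx0 : `|x : H| != 0 by rewrite normr_eq0.
pose y : H := `|x : H|^-1 *: (x : H).
have y1 : `|y| <= 1 by rewrite normrZ normfV normr_id mulVf.
have -> : f x = `|x : H| *: f y by rewrite linearZ/= scalerA mulfV ?scale1r.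
rewrite {1}/real_norm normrZ normr_id -of_real_norm scalar_re_of_realM mulrC.
rewrite ler_wpM2r ?real_norm_ge0// -lee_fin; apply: le_trans fC.
by apply: ereal_sup_ubound; exists y.
Qed.

(** * Reduction from [G] to its generators, and extension back to [G] *)

Theorem theorem5p5 (R : realType) (q p n : nat)
  (p_prime : prime p) (n_gt0 : (0 < n)%N) (qE : q = (p ^ n)%N)
  (G : groupType) (GA2 : A2tilde_group G q)
  (k : scalars) (H : hilbertSpace R k) (pi : G -> {linear H -> H})
  (pi_rep : uniformly_bounded_rep pi)
  (pi_small : (rep_norm pi <
    (Num.sqrt (2 * (1 - Num.sqrt (q%:R : R) / (q%:R + 1))))%:E)%E) :
  H1_vanishes pi.
Proof.
have q_gt0 : (0 < q)%N by rewrite qE expn_gt0 prime_gt0.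
have [S [genS SV _ [F cardF isoF]]] := GA2.
have [side] := incidence_plane_graph isoF; rewrite cardF => pgS.
have [pi_inv piM _] := pi_rep.
(* [pi 1] is idempotent and injective. *)
have pi1 x : pi 1%g x = x.
  have [_ [pi' [pi1K _ _]]] := pi_inv 1%g.
  by apply: (can_inj pi1K); rewrite -piM mulg1.
have opnorm_le g : (opnorm (pi g) <= rep_norm pi)%E.
  by apply: ereal_sup_ubound; exists g.
have N0 : (0 <= rep_norm pi)%E.
  apply: le_trans (opnorm_le 1%g); apply: ereal_sup_ubound; exists 0.
    by rewrite /= normr0.
  by rewrite linear0 normr0 scalar_re0.
have Nfin : rep_norm pi \is a fin_num.
  by rewrite ge0_fin_numE// (lt_trans pi_small) ?ltry.
pose C := fine (rep_norm pi); have C0 : 0 <= C by exact: fine_ge0.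
have CE : rep_norm pi = C%:E by rewrite fineK.
have d0 : 0 < q%:R + 1 :> R by rewrite ltr_wpDl.
have CK : C ^+ 2 * (q%:R + 1) < 2 * ((q%:R + 1) - Num.sqrt q%:R).
  rewrite CE lte_fin in pi_small.
  rewrite -ltr_pdivlMr//.
  have -> : 2 * ((q%:R + 1) - Num.sqrt q%:R) / (q%:R + 1) =
      2 * (1 - Num.sqrt q%:R / (q%:R + 1)) :> R by field; rewrite gt_eqF.
  (* [Num.sqrt] is [0] on negative numbers, so a positive root forces a positive radicand, which
     allows squaring. *)
  have := le_lt_trans C0 pi_small; rewrite sqrtr_gt0 => h.
  by rewrite -(sqr_sqrtr (ltW h)) ltr_pXn2r ?nnegrE ?sqrtr_ge0.
have piK : bounded_rep (@real_dot R k H) (C ^+ 2)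
    (fun g => pi g : realified H -> realified H).
  split=> [g a x y|g h x|//|g x]; [exact: linearP|exact: piM|].
  rewrite !real_dotE -exprMn ler_pXn2r ?nnegrE ?mulr_ge0 ?real_norm_ge0//.
  by apply: opnorm_real_norm; rewrite -CE.
move=> b bZ.
have b1 : b 1%g = 0.
  have := bZ 1%g 1%g; rewrite mulg1 pi1 => /eqP.
  by rewrite -subr_eq0 opprD addNKr oppr_eq0 => /eqP.
have [|v bv] := link_cocycle_coboundary (psd_real_dot H) (@real_dot_eq0 _ _ H)
  (@real_dot_complete _ _ H) SV pgS q_gt0 CK piK
  (b := [ffun s : S => b (val s) : realified H]).
  split=> [s t u stu|s t st]; rewrite !ffunE.
    by rewrite -stu bZ addrK.
  by apply/eqP; rewrite -addr_eq0 -bZ st mulVg b1.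
(* The elements where [b] agrees with the coboundary of [v] form a subgroup, which contains [S] and
   hence is all of [G]. *)
exists v => g; pose A : {pred G} := fun h => `[< b h = v - pi h v >].
have AP h : reflect (b h = v - pi h v) (h \in A) by exact: asboolP.
suff : A =i predT by move=> /(_ g) AT; apply/AP; rewrite AT.
apply: genS => [|s sS]; last first.
  by apply/AP; have /ffunP/(_ (FSetSub sS)) := bv; rewrite !ffunE.
split=> [|x y /AP bx /AP by_]; apply/AP; first by rewrite b1 pi1 subrr.
have byV : b y^-1%g = v - pi y^-1%g v.
  have := bZ y^-1%g y; rewrite mulVg b1 by_ linearB/= -piM mulVg pi1 => /esym/eqP.
  by rewrite addrC addr_eq0 opprB => /eqP.
by rewrite bZ byV bx linearB/= -piM addrC subrKA.
Qed.
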